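(* Let $\delta>0$ and let $L_\delta=\{\delta(s+ik):s,k\in\mathbb{Z},\ s+k\text{ even}\}$, where each point $z$ is adjacent to the four points $z+\delta(\pm1\pm i)$. Let $S=\{2j\delta: j\in\mathbb{Z},\ j\ge0\}\subset L_\delta$ (the slit along the positive real axis), and for $z\in L_\delta$ let $\operatorname{hm}(z)$ denote the probability that simple random walk on $L_\delta$ started at $z$ hits $S$ for the first time at $0$ (so $\operatorname{hm}(0)=1$ and $\operatorname{hm}=0$ on $S\setminus\{0\}$); equivalently $\operatorname{hm}$ is the unique function discrete harmonic on $L_\delta\setminus S$, equal to $1$ at $0$, to $0$ on $S\setminus\{0\}$, and tending to $0$ at infinity. Then for all $s,k\in\mathbb{Z}$ with $s+k$ even, $$\operatorname{hm}\big((s+ik)\delta\big)=\frac{1}{2\pi}\int_{-\pi}^{\pi}\frac{C(\theta)^{|k|}}{\sqrt{1-e^{-2i\theta}}}\,e^{-is\theta}\,d\theta,\qquad C(\theta)=\frac{\cos\theta}{1+|\sin\theta|},$$ where the square root is the principal branch. In particular, for every integer $s\ge0$, $$\operatorname{hm}\big(-2(s+1)\delta\big)=\frac{s+\frac12}{s+1}\,\operatorname{hm}(-2s\delta),$$ and consequently $\operatorname{hm}(-2s\delta)\sim\frac{1}{\sqrt{\pi s}}$ as $s\to\infty$.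
   Context: A function $L$ on $L_\delta$ is discrete harmonic at $x$ if $L(x+(1+i)\delta)+L(x+(1-i)\delta)+L(x-(1+i)\delta)+L(x-(1-i)\delta)=4L(x)$. *)

(* Defs.v *)
From HB Require Import structures.
From mathcomp Require Import all_boot all_order all_algebra.
From mathcomp Require Import all_classical all_reals all_analysis.
From mathcomp Require Import complex.
Set Implicit Arguments. Unset Strict Implicit. Unset Printing Implicit Defensive.
Import Order.TTheory GRing.Theory Num.Theory.
Import numFieldNormedType.Exports.
Local Open Scope ring_scope.

(* A lattice point delta*(s + i k) of L_delta is encoded by the pair (s, k)
   of integers (with s + k even).  The graph structure, the slit S and the
   random walk do not depend on delta (scaling), so delta plays no role. *)
Definition lpt := (int * int)%type.

Definition inS (z : lpt) : bool :=
  [&& z.2 == 0, 0 <= z.1 & (2 %| z.1)%Z].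

Section HM.
Variable R : realType.
Local Open Scope complex_scope.

(* first_hit n z = probability that simple random walk on L_delta started at z
   hits S for the first time at time n, and does so at the point 0.
   (time 0 counts: a walk started on S hits S at time 0.) *)
Fixpoint first_hit (n : nat) (z : lpt) : R :=
  match n with
  | 0%N => if z == (0, 0) then 1 else 0
  | m.+1 => if inS z then 0 else
      4^-1 * (first_hit m (z.1 + 1, z.2 + 1) + first_hit m (z.1 + 1, z.2 - 1)
            + first_hit m (z.1 - 1, z.2 + 1) + first_hit m (z.1 - 1, z.2 - 1))
  end.

(* hm z = probability that the walk started at z first hits S at 0
   (sum over the first hitting time; the sum is a probability, hence finite). *)
Definition hm (z : lpt) : R :=
  fine (\sum_(0 <= n <oo) ((first_hit n z)%:E))%E.

Definition Cth (t : R) : R := cos t / (1 + `|sin t|).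

Definition expi (x : R) : R[i] := (cos x +i* sin x)%C.

Definition hm_integrand (s k : int) (t : R) : R[i] :=
  ((Cth t)%:C ^+ `|k|%N) * expi (- (s%:~R * t)) / sqrtc (1 - expi (- (2 * t))).

End HM.

(* Main.v *)
Require Import Defs.
From HB Require Import structures.
From mathcomp Require Import all_boot all_order all_algebra.
From mathcomp Require Import all_classical all_reals all_analysis.
From mathcomp Require Import complex.
From mathcomp Require Import measurable_realfun.
From mathcomp Require Import ring lra zify.
Import Order.TTheory GRing.Theory Num.Theory.
Import numFieldNormedType.Exports.
Local Open Scope ring_scope.
Local Open Scope classical_set_scope.

Set Implicit Arguments. Unset Strict Implicit. Unset Printing Implicit Defensive.

(** Write [w = exp(-2it)]. For [0 < t < pi] one has
    [1 - w = 2 sin t exp(i(pi/2 - t))], so the integrand is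
    [C^|k| (2 sin t)^(-1/2) exp(-i((s - 1/2)t + pi/4))], and it is conjugated by
    [t -> -t]. The normalised integral is therefore the real number
    [h(s,k) = (pi sqrt 2)^-1 \int_0^pi C^|k| (sin t)^(-1/2) cos((s - 1/2)t + pi/4) dt].

    Off the real axis, [h] is discrete harmonic because [(C^2 + 1) cos t = 2 C].
    On the axis, the primitive [sqrt(sin t) sin(a t + b)] gives a two-term
    recurrence for [\int_0^pi (sin t)^(-1/2) sin(a t + b) dt]; together with
    [h(0,0) = 1], which comes from the primitive [2 asin(sin(t/2) - cos(t/2))] of
    [(cos(t/2) + sin(t/2)) / sqrt(sin t)], it yields the values of [h] on the slit,
    harmonicity at the points left of the slit, and the ratio
    [h(-2(s+1),0) / h(-2s,0)].

    Moreover [|h(s,k)| <= m(|k|)] with [m -> 0]. The difference between [h] and the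
    probability of hitting the slit at 0 within [N] steps is thus bounded by the
    [N]-fold average of [m] under the one-dimensional simple walk in [k]. A Huber
    function, quadratic near 0 and linear at infinity, shows that the Cesaro means
    of these averages vanish, and monotonicity in [N] turns this into convergence,
    so that [hm = h]. The asymptotics of [hm(-2s,0)] is Wallis' formula. *)

(** * Integrals with an endpoint singularity *)

(** The usual fundamental theorem applies on compact intervals exhausting []a, b[], and monotone
    convergence passes to the limit, so [f] may blow up at both ends. *)
Lemma ge0_FTC_oo (R : realType) (f F : R -> R) (a b A B : R) : a < b ->
  (forall x : R, a < x < b -> is_derive x (1 : R) F (f x)) ->
  (forall x : R, a < x < b -> {for x, continuous f}) ->
  (forall x : R, a < x < b -> 0 <= f x) ->
  F x @[x --> a^'+] --> A -> F x @[x --> b^'-] --> B ->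
  (\int[lebesgue_measure]_(x in `]a, b[) (f x)%:E = (B - A)%:E)%E.
Proof.
move=> ab dF cf f0 FA FB.
(* With denominator at least 3, [2 * d n < b - a], so every interval [E n] is nondegenerate,
   including [E 0]. *)
pose d n : R := (b - a) / n.+3%:R.
have d0 n : 0 < d n by rewrite divr_gt0// subr_gt0.
have dcvg : d n @[n --> \oo] --> (0 : R).
  rewrite -[X in _ --> X](mulr0 (b - a)); apply: cvgMr.
  have := @cvg_harmonic R; rewrite -(cvg_shiftn 2) /=.
  by under eq_cvg do rewrite addn2.
have dlt n : d n *+ 2 < b - a.
  rewrite /d -mulrnAl ltr_pdivrMr// -mulr_natr ltr_pM2l ?subr_gt0//.
  by rewrite ltr_nat.
have uv n : a + d n < b - d n.
  by have := dlt n; rewrite mulr2n; lra.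
have ub n : b - d n < b by have := d0 n; lra.
have au n : a < a + d n by have := d0 n; lra.
pose E n : set R := `[a + d n, b - d n].
have bigE : \bigcup_n E n = `]a, b[%classic.
  apply/seteqP; split => x /=.
    move=> [n _]; rewrite /E /= !in_itv/= => /andP[ax xb].
    by rewrite (lt_le_trans (au n) ax) (le_lt_trans xb (ub n)).
  rewrite in_itv/= => /andP[ax xb].
  have e0 : 0 < Num.min (x - a) (b - x) by rewrite lt_min !subr_gt0 ax.
  move/cvgrPdist_lt : dcvg => /(_ _ e0)[n _ Hn].
  exists n => //; rewrite /E /= in_itv/=.
  have := Hn n (leqnn n); rewrite /= sub0r normrN (ger0_norm (ltW (d0 n))) lt_min.
  by move=> /andP[h1 h2]; lra.
have sub n : E n `<=` `]a, b[ by rewrite -bigE; exact: bigcup_sup.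
have mf : measurable_fun `]a, b[ f.
  apply: open_continuous_measurable_fun; first exact: interval_open.
  by move=> x; rewrite inE/= in_itv => /cf.
rewrite -bigE.
have Fn n : (\int[lebesgue_measure]_(x in E n) (f x)%:E =
             (F (b - d n) - F (a + d n))%:E)%E.
  have sub' x : x \in `](a + d n), (b - d n)[%R -> a < x < b.
    by rewrite in_itv/= => /andP[h1 h2];
      rewrite (lt_trans (au n) h1) (lt_trans h2 (ub n)).
  have dFc x : a < x < b -> {for x, continuous F}.
    move=> /dF h; apply: differentiable_continuous.
    by apply/derivable1_diffP; exact: ex_derive.
  rewrite EFinB; apply: continuous_FTC2 => //.
  - apply: continuous_in_subspaceT => x; rewrite inE => /sub/=.
    by rewrite in_itv => /cf.
  - split.
    + by move=> x /sub' /dF h; exact: ex_derive.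
    + apply: cvg_at_right_filter; apply: dFc; rewrite /=.
      by have := uv n; have := ub n; have := au n; move=> *; apply/andP; split; lra.
    + apply: cvg_at_left_filter; apply: dFc; rewrite /=.
      by have := uv n; have := ub n; have := au n; move=> *; apply/andP; split; lra.
  - by move=> x /sub' /dF h; rewrite derive1E; exact: derive_val.
have lim1 : (\int[lebesgue_measure]_(x in E n) (f x)%:E)%E @[n --> \oo] -->
   (\int[lebesgue_measure]_(x in \bigcup_n E n) (f x)%:E)%E.
  apply: ge0_nondecreasing_set_cvg_integral.
  - move=> m n mn; rewrite subsetEset => x; rewrite /E /= !in_itv/= => /andP[h1 h2].
    have : d n <= d m by rewrite ler_pM2l ?subr_gt0// lef_pV2 ?posrE// ler_nat.
    by move=> h; apply/andP; split; lra.
  - by move=> n; exact: measurable_itv.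
  - move=> n; apply/measurable_EFinP; apply: measurable_funS mf => //.
  - by move=> n x /sub/=; rewrite in_itv => /f0; rewrite lee_fin.
have lim2 : (\int[lebesgue_measure]_(x in E n) (f x)%:E)%E @[n --> \oo] -->
   (B - A)%:E.
  under eq_cvg do rewrite Fn.
  apply: cvg_EFin; first exact: nearW.
  apply: cvgB.
  - move/cvg_at_leftP : FB; apply; split => //.
    by rewrite -[X in _ --> X]subr0; apply: cvgB => //; exact: cvg_cst.
  - move/cvg_at_rightP : FA; apply; split => //.
    by rewrite -[X in _ --> X]addr0; apply: cvgD => //; exact: cvg_cst.
exact: (cvg_unique _ lim1 lim2).
Qed.

(** * Integrability of [1 / sqrt (sin t)] on []0, pi[] *)

Section SqrtSin.
Variable R : realType.
Implicit Types (p q F : R -> R) (t x c : R).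

Lemma asin_mono : {in `[(-1 : R), 1]%R &, {mono (@asin R) : x y / x <= y}}.
Proof.
move=> x y xI yI; have bnd z : z \in `[(-1 : R), 1]%R ->
    asin z \in `[(- (pi / 2)), pi / 2]%R.
  by rewrite !in_itv/= => zI; rewrite asin_geNpi2// asin_lepi2.
by rewrite !leNgt -(ltr_sin (bnd _ yI) (bnd _ xI)) !asinK.
Qed.

Lemma asin1 : asin (1 : R) = pi / 2.
Proof.
rewrite -[in LHS]sin_pihalf sinK// in_itv/= lexx andbT.
by have := pi_ge0 R; lra.
Qed.

Lemma asinN1 : asin (-1 : R) = - (pi / 2).
Proof.
rewrite -[in LHS]sin_pihalf -sinN sinK// in_itv/= lexx/=.
by have := pi_ge0 R; lra.
Qed.

(** A monotone map onto an interval is continuous. The endpoints matter: the primitive below is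
    evaluated in the limit at -1 and 1. *)
Lemma asin_within_continuous : {within `[(-1), 1], continuous (@asin R)}.
Proof.
apply: segment_inc_surj_continuous; first exact: asin_mono.
move=> y /=; rewrite asin1 asinN1 => yI.
exists (sin y); first by rewrite in_itv/= sin_geN1 sin_le1.
by rewrite sinK.
Qed.

(** Since [1 - w t ^+ 2 = sin t], the derivative of [asin (w t)] carries exactly the singular factor
    [1 / sqrt (sin t)]. *)
Let w (t : R) : R := sin (t / 2) - cos (t / 2).

Lemma is_derive_halfdiff t :
  is_derive t (1 : R) w ((cos (t / 2) + sin (t / 2)) / 2).
Proof.
have -> : w = (sin \o ( *%R^~ (2^-1 : R))) - (cos \o ( *%R^~ (2^-1 : R))).
  by apply/funext.
apply: is_derive_eq; rewrite /= !scaler0 add0r /GRing.scale /=; ring.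
Qed.

Lemma continuous_halfdiff : continuous w.
Proof.
move=> t; apply: differentiable_continuous; apply/derivable1_diffP.
exact: (@ex_derive _ _ _ _ _ _ _ (is_derive_halfdiff t)).
Qed.

Lemma halfdiff_sqr t : 1 - w t ^+ 2 = sin t.
Proof.
rewrite /w; have := cos2Dsin2 (t / 2).
have -> : sin t = sin (t / 2 *+ 2) by congr sin; rewrite mulr2n; lra.
by rewrite sin_mulr2n mulr2n => h; lra.
Qed.

Lemma halfdiff_itv t : 0 < t < pi -> -1 < w t < 1.
Proof.
move=> t0; have : 0 < 1 - w t ^+ 2 by rewrite halfdiff_sqr sin_gt0_pi.
by move=> h; apply/andP; split; nra.
Qed.

(** Both terms are nonnegative and their squares add up to 1. Hence [g] below dominates
    [1 / sqrt (sin t)]. *)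
Lemma halfsum_ge1 t : 0 < t < pi -> 1 <= cos (t / 2) + sin (t / 2).
Proof.
move=> /andP[t0 tp].
have c0 : 0 <= cos (t / 2) by apply: cos_ge0_pihalf; apply/andP; split; lra.
have s0 : 0 <= sin (t / 2) by apply: sin_ge0_pi; apply/andP; split; lra.
have := cos2Dsin2 (t / 2); nra.
Qed.

Let g (t : R) : R := (cos (t / 2) + sin (t / 2)) / Num.sqrt (sin t).

Lemma is_derive_asin_halfdiff t : 0 < t < pi ->
  is_derive t (1 : R) (fun t => 2 * asin (w t)) (g t).
Proof.
move=> t0.
have dw := is_derive_halfdiff t.
have da := is_derive1_asin (halfdiff_itv t0).
have := @is_deriveZ _ _ _ _ 2 _ _ _ (is_derive1_comp da dw).
rewrite halfdiff_sqr => h; apply: is_derive_eq.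
rewrite /g /GRing.scale /=; field.
by rewrite gt_eqF// sqrtr_gt0 sin_gt0_pi.
Qed.

Lemma continuous_div_sqrt_sin p t : 0 < t < pi -> {for t, continuous p} ->
  {for t, continuous (fun t => p t / Num.sqrt (sin t))}.
Proof.
move=> t0 cp; apply: continuousM => //.
apply: continuousV; first by rewrite gt_eqF// sqrtr_gt0 sin_gt0_pi.
apply: continuous_comp; first exact: continuous_sin.
exact: sqrt_continuous.
Qed.

Lemma halfsum_continuous : continuous (fun t : R => cos (t / 2) + sin (t / 2)).
Proof.
move=> t; apply: continuousD; apply: continuous_comp.
- by apply: continuousM; [exact: cvg_id|exact: cvg_cst].
- exact: continuous_cos.
- by apply: continuousM; [exact: cvg_id|exact: cvg_cst].
- exact: continuous_sin.
Qed.

Lemma halfdiff_incr : {in `[0 : R, pi]%R &, {homo w : x y / x < y}}.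
Proof.
move=> x y; rewrite !in_itv/= => /andP[x0 xp] /andP[y0 yp] xy.
have si z : 0 <= z -> z <= pi -> z / 2 \in `[(- (pi / 2) : R), pi / 2]%R.
  by move=> *; rewrite in_itv/=; apply/andP; split; lra.
have ci z : 0 <= z -> z <= pi -> z / 2 \in `[0 : R, pi]%R.
  by move=> *; rewrite in_itv/=; apply/andP; split; lra.
rewrite /w ltrB// ?ltr_sin ?ltr_cos ?si ?ci//; lra.
Qed.

(** As [w] increases, it approaches -1 from the right, where one-sided continuity of [asin]
    suffices. *)
Lemma cvg_asin_halfdiff0 :
  (fun t => 2 * asin (w t)) x @[x --> 0^'+] --> 2 * asin (-1 : R).
Proof.
apply: cvgMr.
have w0 : w 0 = -1 by rewrite /w mul0r sin0 cos0 sub0r.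
apply: (@increasing_cvg_at_right_comp R w asin 0 (BRight (pi : R))).
- by rewrite bnd_simp pi_gt0.
- exact: halfdiff_incr.
- apply: cvg_at_right_filter; exact: continuous_halfdiff.
- rewrite w0; have := asin_within_continuous.
  by move/continuous_within_itvP => []//; rewrite ltrN10.
Qed.

Lemma cvg_asin_halfdiffpi :
  (fun t => 2 * asin (w t)) x @[x --> (pi : R)^'-] --> 2 * asin (1 : R).
Proof.
apply: cvgMr.
have w1 : w pi = 1 by rewrite /w sin_pihalf cos_pihalf subr0.
apply: (@increasing_cvg_at_left_comp R w asin (BLeft (0 : R)) pi).
- by rewrite bnd_simp pi_gt0.
- exact: halfdiff_incr.
- apply: cvg_at_left_filter; exact: continuous_halfdiff.
- rewrite w1; have := asin_within_continuous.
  by move/continuous_within_itvP => []//; lra.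
Qed.

Lemma integral_halfsum_div_sqrt_sin :
  (\int[lebesgue_measure]_(x in `]0%R, pi[) (g x)%:E = (2 * pi)%:E)%E.
Proof.
have -> : 2 * pi = 2 * asin 1 - 2 * asin (- 1) :> R.
  by rewrite asin1 asinN1; field.
apply: (@ge0_FTC_oo R g (fun t => 2 * asin (w t))).
- exact: pi_gt0.
- by move=> x; exact: is_derive_asin_halfdiff.
- by move=> x x0; apply: continuous_div_sqrt_sin => //; exact: halfsum_continuous.
- move=> x x0; rewrite divr_ge0 ?sqrtr_ge0//.
  by rewrite (le_trans _ (halfsum_ge1 x0)).
- exact: cvg_asin_halfdiff0.
- exact: cvg_asin_halfdiffpi.
Qed.

Local Notation mu := (@lebesgue_measure R).
Local Notation I0pi := (`]0, (pi : R)[%classic).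

Lemma measurable_div_sqrt_sin p : (forall t, 0 < t < pi -> {for t, continuous p}) ->
  measurable_fun I0pi (fun t => p t / Num.sqrt (sin t)).
Proof.
move=> cp; apply: open_continuous_measurable_fun; first exact: interval_open.
move=> t; rewrite inE/= in_itv => t0; apply: continuous_div_sqrt_sin => //.
exact: cp.
Qed.

Lemma integrable_halfsum_div_sqrt_sin : mu.-integrable I0pi (EFin \o g).
Proof.
apply/integrableP; split.
  apply/measurable_EFinP; apply: measurable_div_sqrt_sin => t _.
  exact: halfsum_continuous.
rewrite (_ : integral _ _ _ = (2 * pi)%:E) ?ltry// -integral_halfsum_div_sqrt_sin.
apply: eq_integral => x; rewrite inE/= in_itv => x0.
rewrite ger0_norm// divr_ge0 ?sqrtr_ge0//.
by rewrite (le_trans _ (halfsum_ge1 x0)).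
Qed.

(** Domination by [c * g], the numerator of [g] being at least 1. *)
Lemma integrable_div_sqrt_sin p c : (forall t, 0 < t < pi -> {for t, continuous p}) ->
  (forall t, 0 < t < pi -> `|p t| <= c) ->
  mu.-integrable I0pi (EFin \o (fun t => p t / Num.sqrt (sin t))).
Proof.
move=> cp pc.
have := integrableZl _ c integrable_halfsum_div_sqrt_sin => /(_ (measurable_itv _)).
apply: le_integrable; first exact: measurable_itv.
  by apply/measurable_EFinP; exact: measurable_div_sqrt_sin.
move=> t /=; rewrite in_itv => t0.
have c0 : 0 <= c by rewrite (le_trans (normr_ge0 (p t))) ?pc.
rewrite lee_fin /g !normrM [`|c|]ger0_norm// mulrA ler_wpM2r//.
rewrite -[X in X <= _]mulr1 ler_pM ?pc//.
by rewrite (le_trans (halfsum_ge1 t0)) ?ler_norm.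
Qed.

End SqrtSin.

(** * Integrals against [1 / sqrt (sin t)] *)

Section WInt.
Variable R : realType.
Implicit Types (p q F : R -> R) (t x c a b : R).
Local Notation mu := (@lebesgue_measure R).
Local Notation I0pi := (`]0, (pi : R)[%classic).

(** A class of numerators closed under sums and products, whose quotient by [sqrt (sin t)] is always
    integrable. *)
Definition bcont p := (forall t, 0 < t < pi -> {for t, continuous p}) /\
  exists c, forall t, 0 < t < pi -> `|p t| <= c.

Definition wint p : R := Rintegral mu I0pi (fun t => p t / Num.sqrt (sin t)).

Lemma bcont_integrable p : bcont p ->
  mu.-integrable I0pi (EFin \o (fun t => p t / Num.sqrt (sin t))).
Proof. by move=> [cp [c pc]]; exact: integrable_div_sqrt_sin cp pc. Qed.

Lemma bcont_cst c : bcont (cst c).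
Proof. by split; [move=> t _; exact: cvg_cst|exists `|c|]. Qed.

Lemma bcontD p q : bcont p -> bcont q -> bcont (fun t => p t + q t).
Proof.
move=> [cp [c pc]] [cq [d qd]]; split.
  by move=> t t0; apply: continuousD; [exact: cp|exact: cq].
by exists (c + d) => t t0; rewrite (le_trans (ler_normD _ _))// lerD ?pc ?qd.
Qed.

Lemma bcontM p q : bcont p -> bcont q -> bcont (fun t => p t * q t).
Proof.
move=> [cp [c pc]] [cq [d qd]]; split.
  by move=> t t0; apply: continuousM; [exact: cp|exact: cq].
by exists (c * d) => t t0; rewrite normrM ler_pM ?pc ?qd.
Qed.

Lemma bcontZ a p : bcont p -> bcont (fun t => a * p t).
Proof. exact/bcontM/bcont_cst. Qed.

Lemma bcontB p q : bcont p -> bcont q -> bcont (fun t => p t - q t).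
Proof.
move=> bp /(bcontZ (-1)) /(bcontD bp).
by under eq_fun do rewrite mulN1r.
Qed.

Lemma bcontX p n : bcont p -> bcont (fun t => p t ^+ n).
Proof.
move=> bp; elim: n => [|n IH]; first exact: bcont_cst.
by under eq_fun do rewrite exprS; exact: bcontM.
Qed.

Lemma bcont_norm p : bcont p -> bcont (fun t => `|p t|).
Proof.
move=> [cp [c pc]]; split.
  by move=> t t0; apply: continuous_comp; [exact: cp|exact: norm_continuous].
by exists c => t t0; rewrite normr_id pc.
Qed.

Lemma continuous_affine a b : continuous (fun t : R => a * t + b).
Proof.
move=> t; apply: continuousD; last exact: cvg_cst.
by apply: continuousM; [exact: cvg_cst|exact: cvg_id].
Qed.

Lemma bcont_sin a b : bcont (fun t => sin (a * t + b)).
Proof.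
split; last by exists 1 => t _; exact: sin_max.
move=> t _; apply: continuous_comp; first exact: continuous_affine.
exact: continuous_sin.
Qed.

Lemma bcont_cos a b : bcont (fun t => cos (a * t + b)).
Proof.
split; last by exists 1 => t _; exact: cos_max.
move=> t _; apply: continuous_comp; first exact: continuous_affine.
exact: continuous_cos.
Qed.

Lemma bcont_halfsum : bcont (fun t => cos (t / 2) + sin (t / 2)).
Proof.
have h t : t / 2 = 2^-1 * t + 0 by rewrite addr0 mulrC.
by apply: bcontD; under eq_fun do rewrite h; [exact: bcont_cos|exact: bcont_sin].
Qed.

Lemma eq_wint p q : (forall t, 0 < t < pi -> p t = q t) -> wint p = wint q.
Proof.
by move=> pq; apply: eq_Rintegral => t; rewrite inE/= in_itv => /pq ->.
Qed.

Lemma wintD p q : bcont p -> bcont q ->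
  wint (fun t => p t + q t) = wint p + wint q.
Proof.
move=> bp bq; rewrite /wint; under eq_Rintegral do rewrite mulrDl.
by rewrite RintegralD//; exact: bcont_integrable.
Qed.

Lemma wintZ a p : bcont p -> wint (fun t => a * p t) = a * wint p.
Proof.
move=> bp; rewrite /wint; under eq_Rintegral do rewrite -mulrA.
by rewrite RintegralZl//; exact: bcont_integrable.
Qed.

Lemma wintB p q : bcont p -> bcont q ->
  wint (fun t => p t - q t) = wint p - wint q.
Proof.
move=> bp bq; under [fun t => _]eq_fun do rewrite -mulN1r.
by rewrite wintD ?wintZ ?mulN1r//; exact: bcontZ.
Qed.

Lemma le_wint p q : bcont p -> bcont q ->
  (forall t, 0 < t < pi -> p t <= q t) -> wint p <= wint q.
Proof.
move=> bp bq pq; apply: le_Rintegral; rewrite //=; try exact: bcont_integrable.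
by move=> t /=; rewrite in_itv => /pq h; rewrite ler_wpM2r ?invr_ge0 ?sqrtr_ge0.
Qed.

Lemma le_norm_wint p : bcont p -> `|wint p| <= wint (fun t => `|p t|).
Proof.
move=> bp; rewrite (le_trans (le_normr_Rintegral _ (bcont_integrable bp)))//.
rewrite le_eqVlt; apply/orP; left; apply/eqP/eq_Rintegral => t _.
by rewrite normrM [`|_^-1|]ger0_norm ?invr_ge0 ?sqrtr_ge0.
Qed.

Lemma wint_halfsum : wint (fun t => cos (t / 2) + sin (t / 2)) = 2 * pi.
Proof. by rewrite /wint /Rintegral integral_halfsum_div_sqrt_sin. Qed.

(* Adding a large multiple of [cos (t/2) + sin (t/2)], whose integral is known,
   reduces the claim to a nonnegative integrand. *)
Lemma wint_FTC p F (A B : R) : bcont p ->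
  (forall t, 0 < t < pi -> is_derive t (1 : R) F (p t / Num.sqrt (sin t))) ->
  F x @[x --> 0^'+] --> A -> F x @[x --> (pi : R)^'-] --> B ->
  wint p = B - A.
Proof.
move=> bp dF FA FB; have [cp [c pc]] := bp.
pose h t := cos (t / 2) + sin (t / 2).
have bh : bcont h := bcont_halfsum.
suff : wint (fun t => p t + c * h t) = B - A + c * (2 * pi).
  rewrite wintD ?wintZ ?wint_halfsum//; last exact: bcontZ.
  exact: addIr.
rewrite /wint /Rintegral.
pose G t := F t + c * (2 * asin (sin (t / 2) - cos (t / 2))).
suff -> : (\int[mu]_(x in I0pi) ((p x + c * h x) / Num.sqrt (sin x))%:E =
    ((B + c * (2 * asin 1)) - (A + c * (2 * asin (- 1))))%:E)%E.
  by rewrite /= asin1 asinN1; field.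
apply: (@ge0_FTC_oo R _ G); first exact: pi_gt0.
- move=> t t0; rewrite mulrDl -mulrA.
  apply: is_deriveD; first exact: dF.
  exact: is_deriveZ (is_derive_asin_halfdiff t0).
- move=> t t0; apply: continuous_div_sqrt_sin => //.
  by have [h1 _] := bcontD bp (bcontZ c bh); exact: h1.
- move=> t t0; rewrite divr_ge0 ?sqrtr_ge0//.
  have := pc _ t0; rewrite ler_norml => /andP[p1 p2].
  have : 1 <= h t := halfsum_ge1 t0.
  have : 0 <= c by rewrite (le_trans (normr_ge0 (p t))) ?pc.
  by move=> *; nra.
- by apply: cvgD => //; apply: cvgMr; exact: cvg_asin_halfdiff0.
- by apply: cvgD => //; apply: cvgMr; exact: cvg_asin_halfdiffpi.
Qed.

Definition sint (a b : R) := wint (fun t => sin (a * t + b)).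

Lemma is_derive_sin_affine a b t :
  is_derive t (1 : R) (fun t => sin (a * t + b)) (a * cos (a * t + b)).
Proof.
have -> : (fun t => sin (a * t + b)) = sin \o (( *%R a) \+ cst b) by apply/funext.
by apply: is_derive_eq; rewrite /= /GRing.scale /=; ring.
Qed.

(** The primitive [F = 2 sqrt(sin t) sin(a t + b)] vanishes at 0 and [pi]. Its derivative times
    [sqrt(sin t)] is [cos t sin(a t + b) + 2 a sin t cos(a t + b)], which the addition formulas turn
    into the difference of the two sides. *)
Lemma sint_rec a b :
  (a + 2^-1) * sint (a + 1) b = (a - 2^-1) * sint (a - 1) b.
Proof.
apply/eqP; rewrite -subr_eq0; apply/eqP.
rewrite /sint -!wintZ -?wintB; try by do ?apply: bcontZ; exact: bcont_sin.
pose F t := 2 * (Num.sqrt (sin t) * sin (a * t + b)).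
have cF : continuous F.
  move=> t; apply: cvgMr; apply: cvgM.
    apply: (@continuous_comp _ _ _ (@sin R) (@Num.sqrt R)).
      exact: continuous_sin.
    exact: sqrt_continuous.
  apply: (@continuous_comp _ _ _ (fun t => a * t + b) (@sin R)).
    exact: continuous_affine.
  exact: continuous_sin.
have -> : 0 = F pi - F 0 by rewrite /F sinpi sin0 sqrtr0; ring.
apply: (@wint_FTC _ F).
- by apply: bcontB; apply: bcontZ; exact: bcont_sin.
- move=> t t0; have st := sin_gt0_pi t0.
  have ds := is_derive1_comp (is_derive1_sqrt st) (is_derive_sin t).
  have := is_deriveZ 2 (is_deriveM ds (is_derive_sin_affine a b t)).
  move=> h; apply: is_derive_eq.
  rewrite /GRing.scale /=.
  have -> : (a + 1) * t + b = (a * t + b) + t by ring.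
  have -> : (a - 1) * t + b = (a * t + b) - t by ring.
  rewrite (sinD (a * t + b) t) (sinB (a * t + b) t).
  have : Num.sqrt (sin t) != 0 by rewrite gt_eqF// sqrtr_gt0.
  have : sin t = Num.sqrt (sin t) ^+ 2 by rewrite sqr_sqrtr// ltW.
  set r := Num.sqrt _ => -> r0.
  by field.
- by apply: cvg_at_right_filter; exact: cF.
- by apply: cvg_at_left_filter; exact: cF.
Qed.
End WInt.

(** * The integral representation as a real harmonic function *)

Section Kernel.
Variable R : realType.
Implicit Types (t x : R) (n : nat).

Definition wave x t : R := cos ((x - 2^-1) * t + pi / 4).

(** Here [n] stands for [|k|]. The constant is [2 / (2 pi)], from folding [[-pi, pi]] onto []0,
    pi[], times the [1 / sqrt 2] left by [sqrt (2 sin t)]. *)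
Definition hmint x n : R :=
  (pi * Num.sqrt 2)^-1 * wint (fun t => Cth t ^+ n * wave x t).

Lemma bcont_wave x : bcont (wave x).
Proof. exact: bcont_cos. Qed.

Lemma norm_Cth_le1 t : `|Cth t| <= 1.
Proof.
have s0 : 0 < 1 + `|sin t| by rewrite (lt_le_trans ltr01)// lerDl.
rewrite /Cth normrM normfV (gtr0_norm s0) ler_pdivrMr// mul1r.
by rewrite (le_trans (cos_max t))// lerDl.
Qed.

Lemma bcont_Cth : bcont (@Cth R).
Proof.
split; last by exists 1 => t _; exact: norm_Cth_le1.
move=> t _; apply: continuousM; first exact: continuous_cos.
apply: continuousV; first by rewrite gt_eqF// (lt_le_trans ltr01)// lerDl.
apply: continuousD; first exact: cvg_cst.
apply: continuous_comp; first exact: continuous_sin.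
exact: norm_continuous.
Qed.

Lemma bcont_Cth_wave x n : bcont (fun t => Cth t ^+ n * wave x t).
Proof. by apply: bcontM (bcont_wave x); apply: bcontX bcont_Cth. Qed.

Lemma wave_shift x t : wave (x + 1) t + wave (x - 1) t = 2 * cos t * wave x t.
Proof.
rewrite /wave.
have -> : (x + 1 - 2^-1) * t + pi / 4 = ((x - 2^-1) * t + pi / 4) + t by ring.
have -> : (x - 1 - 2^-1) * t + pi / 4 = ((x - 2^-1) * t + pi / 4) - t by ring.
rewrite (cosD (_ + _) t) (cosB (_ + _) t); ring.
Qed.

(** The characteristic equation of the discrete Laplacian: horizontal shifts of [wave] contribute
    [2 cos t], so powers of [Cth t] are the matching vertical factor. *)
Lemma Cth_rec t : (Cth t ^+ 2 + 1) * cos t = 2 * Cth t.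
Proof.
have s0 : 0 < 1 + `|sin t| by rewrite (lt_le_trans ltr01)// lerDl.
rewrite /Cth.
have : cos t ^+ 2 = 1 - `|sin t| ^+ 2.
  by rewrite cos2sin2 real_normK ?num_real.
move: s0; set s := `|sin t|; set c := cos t => s0 h.
apply/eqP; rewrite -subr_eq0; apply/eqP.
rewrite (_ : _ - _ = c * (c ^+ 2 - (1 - s ^+ 2)) / (1 + s) ^+ 2).
  by rewrite h subrr mulr0 mul0r.
by field; rewrite gt_eqF.
Qed.

(** Harmonicity holds already under the integral sign, by [wave_shift] and [Cth_rec]; [n.+1] is
    [|k|] at a point off the real axis. *)
Lemma hmint_harmonic x n : hmint (x + 1) n.+2 + hmint (x - 1) n.+2 +
  (hmint (x + 1) n + hmint (x - 1) n) = 4 * hmint x n.+1.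
Proof.
rewrite /hmint -!mulrDr mulrCA; congr (_ * _).
have bc := bcont_Cth_wave.
rewrite -!wintD -?wintZ//; try by do ?apply: bcontD; exact: bc.
apply: eq_wint => t _.
rewrite -!mulrDr wave_shift -mulrDl exprS exprS.
have := Cth_rec t; rewrite expr2 => h.
transitivity (2 * Cth t ^+ n * ((Cth t * Cth t + 1) * cos t) * wave x t).
  by ring.
by rewrite h; ring.
Qed.

Lemma sint_wave x : wint (wave x) = sint (x - 2^-1) (pi / 4 + pi / 2).
Proof.
by apply: eq_wint => t _; rewrite /wave addrA sinDpihalf.
Qed.

Lemma hmint0E x : hmint x 0 = (pi * Num.sqrt 2)^-1 * wint (wave x).
Proof. by congr (_ * _); apply: eq_wint => t _; rewrite mul1r. Qed.

(** This is [sint_rec] at [a = x + 1/2], the cosine being a sine shifted by [pi / 2]. *)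
Lemma hmint_slit_rec x : (x + 1) * hmint (x + 2) 0 = x * hmint x 0.
Proof.
rewrite !hmint0E !sint_wave mulrCA [RHS]mulrCA; congr (_ * _).
have := sint_rec (x + 2^-1) (pi / 4 + pi / 2).
rewrite (_ : x + 2^-1 + 2^-1 = x + 1); last by field.
rewrite (_ : x + 2^-1 + 1 = x + 2 - 2^-1); last by field.
rewrite (_ : x + 2^-1 - 2^-1 = x); last by field.
by rewrite (_ : x + 2^-1 - 1 = x - 2^-1); last by field.
Qed.

Lemma cos_piquarter : cos (pi / 4) = (Num.sqrt 2)^-1 :> R.
Proof.
have c0 : 0 < cos (pi / 4 : R).
  by apply: cos_gt0_pihalf; have := pi_gt0 R; move=> *; apply/andP; split; lra.
have h : cos (pi / 4 : R) ^+ 2 = 2^-1.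
  have := cos_pihalf R; have -> : pi / 2 = pi / 4 *+ 2 :> R by rewrite mulr2n; field.
  rewrite cos_mulr2n mulr2n => h; lra.
by rewrite -sqrtrV// -h sqrtr_sqr gtr0_norm.
Qed.

Lemma sin_piquarter : sin (pi / 4) = (Num.sqrt 2)^-1 :> R.
Proof.
have := cosB (pi / 2 : R) (pi / 4).
rewrite cos_pihalf sin_pihalf mul0r mul1r add0r => <-.
by rewrite (_ : pi / 2 - pi / 4 = pi / 4) ?cos_piquarter//; field.
Qed.

(** At [x = 0] the wave is [cos(pi/4 - t/2)], a multiple of the half-angle sum whose weighted
    integral is [2 * pi]. *)
Lemma hmint_origin : hmint 0 0 = 1.
Proof.
have r0 : Num.sqrt 2 != 0 :> R by rewrite gt_eqF// sqrtr_gt0.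
have p0 : pi != 0 :> R by rewrite gt_eqF// pi_gt0.
rewrite hmint0E.
rewrite (@eq_wint _ _ (fun t => (Num.sqrt 2)^-1 * (cos (t / 2) + sin (t / 2)))).
  rewrite wintZ ?wint_halfsum; last exact: bcont_halfsum.
  have : (Num.sqrt 2) ^+ 2 = 2 :> R by rewrite sqr_sqrtr.
  move=> h; rewrite -[X in _ * (_ * (X * _))]h.
  by move: (pi : R) p0 => p p0; field; rewrite p0 r0.
move=> t _; rewrite /wave.
have -> : (0 - 2^-1) * t + pi / 4 = pi / 4 - t / 2 by ring.
by rewrite cosB cos_piquarter sin_piquarter; ring.
Qed.

(** The factor [x] of the recurrence vanishes at 0, which kills the value at 2; the zero then
    propagates along the slit. *)
Lemma hmint_slit_pos n : hmint (2 * n.+1%:R) 0 = 0.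
Proof.
elim: n => [|n IH].
  by have := hmint_slit_rec 0; rewrite !add0r mul0r mul1r mulr1.
have := hmint_slit_rec (2 * n.+1%:R); rewrite IH mulr0.
have -> : 2 * n.+1%:R + 2 = 2 * n.+2%:R :> R by rewrite -(natr1 n.+1) mulrDr mulr1.
move/eqP; rewrite mulf_eq0 => /orP[|/eqP//].
by rewrite gt_eqF// ltr_pwDr// mulr_ge0.
Qed.

Lemma hmint_slit_neg n :
  hmint (- (2 * n.+1%:R)) 0 = (n%:R + 2^-1) / n.+1%:R * hmint (- (2 * n%:R)) 0.
Proof.
have := hmint_slit_rec (- (2 * n.+1%:R)).
have -> : - (2 * n.+1%:R) + 2 = - (2 * n%:R) :> R by rewrite -natr1; ring.
have n0 : n.+1%:R != 0 :> R by rewrite pnatr_eq0.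
move=> h; have -> : hmint (- (2 * n.+1%:R)) 0 =
    - (2 * n.+1%:R) * hmint (- (2 * n.+1%:R)) 0 / - (2 * n.+1%:R).
  by field.
rewrite -h; move: n0; rewrite -natr1 => n0; field; lra.
Qed.

(** At [a = -1/2] the left factor of [sint_rec] vanishes and gives the case [n = 0]; steps of -2 in
    [a] propagate the zero. These are the error terms of harmonicity left of the slit. *)
Lemma sint_neg n : sint (- (2 * n%:R) - 3 / 2) (pi / 4 : R) = 0.
Proof.
elim: n => [|n IH].
  have := sint_rec (- 2^-1) (pi / 4 : R).
  rewrite addNr mul0r.
  have -> : - 2^-1 - 1 = - (2 * 0) - 3 / 2 :> R by field.
  by move/esym/eqP; rewrite mulf_eq0 => /orP[/eqP|/eqP//]; lra.
have := sint_rec (- (2 * n%:R) - 5 / 2) (pi / 4 : R).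
have -> : - (2 * n%:R) - 5 / 2 + 1 = - (2 * n%:R) - 3 / 2 :> R by field.
have -> : - (2 * n%:R) - 5 / 2 - 1 = - (2 * n.+1%:R) - 3 / 2 :> R.
  by rewrite -(natr1 n); field.
rewrite IH mulr0 => /esym/eqP; rewrite mulf_eq0 => /orP[/eqP|/eqP//].
by have : 0 <= n%:R :> R by []; lra.
Qed.

(** On the axis the upper and lower neighbours both have [|k| = 1], which halves the mean value
    equation. As [Cth t * cos t = 1 - sin t], its defect is the integral of [2 sin t * wave x t], a
    difference of two [sint] terms that vanish by [sint_neg]. *)
Lemma hmint_harmonic_slit n : let x := - (2 * n.+1%:R) in
  hmint (x + 1) 1 + hmint (x - 1) 1 = 2 * hmint x 0.
Proof.
move=> x.
rewrite /hmint -!mulrDr mulrCA; congr (_ * _).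
have bc := bcont_Cth_wave.
rewrite -wintD//.
have bs (y : R) : bcont (fun t => sin (y * t + pi / 4)) by exact: bcont_sin.
transitivity (wint (fun t => 2 * (Cth t ^+ 0 * wave x t) -
   (sin ((x + 2^-1) * t + pi / 4) - sin ((x - 3 / 2) * t + pi / 4)))).
  apply: eq_wint => t t0; rewrite !expr0 expr1 mul1r -mulrDr wave_shift.
  have st := sin_gt0_pi t0.
  have h : Cth t * cos t = 1 - sin t.
    rewrite /Cth gtr0_norm// mulrAC -expr2 cos2sin2.
    by field; rewrite gt_eqF// addr_gt0.
  rewrite [LHS](_ : _ = 2 * (Cth t * cos t) * wave x t); last by ring.
  rewrite h.
  have -> : (x + 2^-1) * t + pi / 4 = ((x - 2^-1) * t + pi / 4) + t by field.
  have -> : (x - 3 / 2) * t + pi / 4 = ((x - 2^-1) * t + pi / 4) - t by field.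
  rewrite (sinD (_ + _) t) (sinB (_ + _) t) /wave; ring.
rewrite wintB ?wintZ ?wintB//;
  try by do ?[apply: bcontZ | apply: bcontB];
    first [exact: bs|exact: bcont_wave].
have -> : x + 2^-1 = - (2 * n%:R) - 3 / 2 by rewrite /x -natr1; field.
have -> : x - 3 / 2 = - (2 * n.+1%:R) - 3 / 2 by [].
have h := sint_neg; rewrite /sint in h.
by rewrite !h !subr0.
Qed.

End Kernel.

(** * Uniform decay away from the real axis *)

Section Decay.
Variable R : realType.
Implicit Types (t x : R) (n : nat).

Definition hmbound n : R :=
  (pi * Num.sqrt 2)^-1 * wint (fun t => `|Cth t| ^+ n).

Lemma bcont_norm_CthX n : bcont (fun t : R => `|Cth t| ^+ n).
Proof. by apply: bcontX; apply: bcont_norm; exact: bcont_Cth. Qed.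

Lemma norm_hmint_le x n : `|hmint x n| <= hmbound n.
Proof.
have c0 : 0 <= (pi * Num.sqrt 2)^-1 :> R.
  by rewrite invr_ge0 mulr_ge0 ?pi_ge0 ?sqrtr_ge0.
rewrite /hmint /hmbound normrM (ger0_norm c0) ler_wpM2l//.
rewrite (le_trans (le_norm_wint (bcont_Cth_wave x n)))//.
apply: le_wint; first exact/bcont_norm/bcont_Cth_wave.
  exact: bcont_norm_CthX.
by move=> t _; rewrite normrM normrX ler_piMr ?exprn_ge0// cos_max.
Qed.

Lemma norm_Cth_lt1 t : 0 < t < pi -> `|Cth t| < 1.
Proof.
move=> /sin_gt0_pi st; rewrite /Cth normrM normfV (gtr0_norm st) (gtr0_norm (addr_gt0 ltr01 st)).
by rewrite ltr_pdivrMr ?addr_gt0// mul1r (le_lt_trans (cos_max t))// ltrDl.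
Qed.

(** Dominated convergence: [|Cth t| < 1] on the open interval, and the integrand for [n = 0]
    dominates all the others. *)
Lemma hmbound_cvg0 : hmbound n @[n --> \oo] --> (0 : R).
Proof.
rewrite -[X in _ --> X](mulr0 (pi * Num.sqrt 2)^-1); apply: cvgMr.
rewrite /wint /Rintegral.
pose f n t := (`|Cth t| ^+ n / Num.sqrt (sin t))%:E.
have b1 := bcont_integrable (bcont_norm_CthX 0).
have [||||||_ _] := @dominated_convergence _ _ R (@lebesgue_measure R)
   (`]0, pi[%classic) _ f (cst 0%E) (fun t => (`|Cth t| ^+ 0 / Num.sqrt (sin t))%:E).
- exact: measurable_itv.
- by move=> n; exact: measurable_int (bcont_integrable (bcont_norm_CthX n)).
- exact: measurable_cst.
- apply: aeW => t /=; rewrite in_itv => t0.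
  apply: cvg_EFin; first exact: nearW.
  rewrite -[X in _ --> X](mul0r (Num.sqrt (sin t))^-1); apply: cvgMl.
  by apply: cvg_expr; rewrite normr_id norm_Cth_lt1.
- exact: b1.
- apply: aeW => t n /= _.
  rewrite lee_fin ger0_norm ?divr_ge0 ?sqrtr_ge0 ?exprn_ge0//.
  by rewrite ler_wpM2r ?invr_ge0 ?sqrtr_ge0// expr0 exprn_ile1 ?norm_Cth_le1.
rewrite integral_cst// mul0e; move/fine_cvg; exact.
Qed.

End Decay.

(** * Wallis' formula *)

Section Wallis.
Variable R : realType.
Implicit Types (t x : R) (n : nat).

(* The factor [Num.sqrt (sin t)] cancels the weight of [wint]: this is the
   integral of [sin t ^+ n] over [0, pi]. *)
Definition sinX_int n : R := wint (fun t => sin t ^+ n * Num.sqrt (sin t)).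

Lemma bcont_sinX n : bcont (fun t : R => sin t ^+ n * Num.sqrt (sin t)).
Proof.
apply: bcontM.
  apply: bcontX; split; last by exists 1 => t _; exact: sin_max.
  by move=> t _; exact: continuous_sin.
split.
  move=> t _; apply: continuous_comp; first exact: continuous_sin.
  exact: sqrt_continuous.
exists 1 => t _; rewrite ger0_norm ?sqrtr_ge0// -[X in _ <= X]sqrtr1.
by rewrite ler_wsqrtr// sin_le1.
Qed.

(** The primitive [- cos t sin^(n+1) t] vanishes at both ends. *)
Lemma sinX_intE n : sinX_int n.+2 * n.+2%:R = sinX_int n * n.+1%:R.
Proof.
apply/eqP; rewrite -subr_eq0; apply/eqP.
rewrite /sinX_int ![_ * _%:R]mulrC -!wintZ; try exact: bcont_sinX.
rewrite -wintB; try by apply: bcontZ; exact: bcont_sinX.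
pose F t : R := - cos t * sin t ^+ n.+1.
have dF t : is_derive t (1 : R) F
    (n.+2%:R * sin t ^+ n.+2 - n.+1%:R * sin t ^+ n).
  have := is_deriveM (is_deriveN (is_derive_cos t))
    (@is_deriveX _ _ _ n.+1 _ _ _ (is_derive_sin t)).
  rewrite (_ : _ * _ = F); last by apply/funext => x; rewrite /F /= fctE exprfctE.
  move=> h; apply: is_derive_eq; rewrite /GRing.scale /= opprK.
  rewrite exprfctE -[(- cos) t]/(- cos t) -(natr1 n.+1) 3!exprS.
  have := cos2Dsin2 t; set c := cos t; set s := sin t; set q := s ^+ n => e.
  have {}e : c ^+ 2 = 1 - s ^+ 2 by lra.
  transitivity (s * (s * q) - n.+1%:R * q * c ^+ 2); first by ring.
  by rewrite e; ring.
have cF : continuous F.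
  by move=> t; apply/differentiable_continuous/derivable1_diffP;
    exact: (@ex_derive _ _ _ _ _ _ _ (dF t)).
have -> : 0 = F pi - F 0.
  by rewrite /F sinpi sin0 !expr0n /= !mulr0 subrr.
apply: (@wint_FTC R _ F).
- by apply: bcontB; apply: bcontZ; exact: bcont_sinX.
- move=> t t0; have st := sin_gt0_pi t0.
  rewrite (_ : _ / _ = n.+2%:R * sin t ^+ n.+2 - n.+1%:R * sin t ^+ n)//.
  by field; rewrite gt_eqF ?sqrtr_gt0.
- by apply: cvg_at_right_filter; exact: cF.
- by apply: cvg_at_left_filter; exact: cF.
Qed.

Lemma sinX_int0 : sinX_int 0 = pi.
Proof.
rewrite -[RHS]subr0; apply: (@wint_FTC R _ id).
- exact: bcont_sinX.
- move=> t t0; rewrite expr0 mul1r divff ?gt_eqF ?sqrtr_gt0 ?sin_gt0_pi//.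
  exact: is_derive_id.
- by apply: cvg_at_right_filter; exact: cvg_id.
- by apply: cvg_at_left_filter; exact: cvg_id.
Qed.

Lemma sinX_int1 : sinX_int 1 = 2.
Proof.
have -> : 2 = - cos (pi : R) - (- cos 0) :> R by rewrite cospi cos0; ring.
have cF : continuous (fun t : R => - cos t).
  by move=> t; apply: cvgN; exact: continuous_cos.
apply: (@wint_FTC R _ (fun t => - cos t)).
- exact: bcont_sinX.
- move=> t t0; rewrite expr1 mulfK ?gt_eqF ?sqrtr_gt0 ?sin_gt0_pi//.
  by rewrite -[X in is_derive _ _ _ X]opprK; exact: is_deriveN.
- by apply: cvg_at_right_filter; exact: cF.
- by apply: cvg_at_left_filter; exact: cF.
Qed.

Lemma sinX_int_noninc n : sinX_int n.+1 <= sinX_int n.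
Proof.
apply: le_wint; try exact: bcont_sinX.
move=> t t0; have st := sin_gt0_pi t0.
by rewrite ler_wpM2r ?sqrtr_ge0// exprS ler_piMl ?exprn_ge0 ?sin_le1// ltW.
Qed.

(** By [sinX_intE] the product does not depend on [n]. *)
Lemma sinX_int_prod n : n.+1%:R * sinX_int n * sinX_int n.+1 = 2 * pi.
Proof.
elim: n => [|n IH]; first by rewrite sinX_int0 sinX_int1; ring.
by rewrite -IH mulrAC [_ * sinX_int n.+2]mulrC sinX_intE; ring.
Qed.

(** The values on the negative axis, given by their ratio alone: the central binomial coefficients
    divided by [4^n]. *)
Variable a : nat -> R.
Hypothesis a0 : a 0 = 1.
Hypothesis aS : forall n, a n.+1 = (n%:R + 2^-1) / n.+1%:R * a n.

Lemma sinX_int_even n : sinX_int (2 * n)%N = pi * a n.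
Proof.
elim: n => [|n IH]; first by rewrite a0 mulr1 sinX_int0.
have e : (2 * n.+1 = (2 * n).+2)%N by lia.
have n0 : (2 * n).+2%:R != 0 :> R by rewrite pnatr_eq0.
have := sinX_intE (2 * n); rewrite IH -e => h.
apply: (mulIf (_ : (2 * n.+1)%:R != 0)); first by rewrite e.
rewrite h aS -(natr1 (2 * n)) !natrM -(natr1 n); field.
by rewrite natr1 pnatr_eq0.
Qed.

(** Comparing the constant product of consecutive integrals with the square of the even one gives
    [pi n a_n^2 <= 1 <= pi (n + 1/2) a_n^2]. *)
Lemma wallis_cvg : a n * Num.sqrt (pi * n%:R) @[n --> \oo] --> (1 : R).
Proof.
have p0 := pi_gt0 R.
have age0 n : 0 <= a n.
  elim: n => [|n IH]; first by rewrite a0.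
  by rewrite aS mulr_ge0// divr_ge0// addr_ge0// invr_ge0.
have up n : a n ^+ 2 * (pi * n%:R) <= 1.
  case: n => [|n]; first by rewrite !mulr0.
  have := sinX_int_prod (2 * n).+1; have := sinX_int_noninc (2 * n).+1.
  have -> : ((2 * n).+2 = 2 * n.+1)%N by lia.
  rewrite sinX_int_even natrM => h1 h2.
  have h3 : n.+1%:R * a n.+1 * sinX_int (2 * n).+1 = 1.
    apply: (mulfI (_ : 2 * pi != 0 :> R)); first by rewrite mulf_neq0// gt_eqF.
    by rewrite mulr1 -[RHS]h2; ring.
  rewrite -[X in _ <= X]h3 (_ : a n.+1 ^+ 2 * _ = n.+1%:R * a n.+1 * (pi * a n.+1)); last by ring.
  by rewrite ler_wpM2l// mulr_ge0.
have low n : 1 <= a n ^+ 2 * (pi * (n%:R + 2^-1)).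
  have := sinX_int_prod (2 * n); have := sinX_int_noninc (2 * n).
  rewrite sinX_int_even -natr1 natrM => h1 h2.
  have h3 : (n%:R + 2^-1) * a n * sinX_int (2 * n).+1 = 1.
    apply: (mulfI (_ : 2 * pi != 0 :> R)); first by rewrite mulf_neq0// gt_eqF.
    by rewrite mulr1 -[RHS]h2; field.
  rewrite -[X in X <= _]h3 (_ : a n ^+ 2 * _ = (n%:R + 2^-1) * a n * (pi * a n)); last by ring.
  by rewrite ler_wpM2l// mulr_ge0// addr_ge0// invr_ge0.
pose x n := a n * Num.sqrt (pi * n%:R).
have x0 n : 0 <= x n by rewrite mulr_ge0 ?sqrtr_ge0.
have x2 n : x n ^+ 2 = a n ^+ 2 * (pi * n%:R).
  by rewrite exprMn sqr_sqrtr// mulr_ge0// ltW.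
have xle n : x n <= 1.
  by have := up n; rewrite -x2; have := x0 n; nra.
(* Since [0 <= x n <= 1], it suffices to bound the square, and [n / (n + 1/2) >= n / (n + 1)]. *)
have xge n : 1 - n.+1%:R^-1 <= x n.
  have : x n ^+ 2 <= x n by have := x0 n; have := xle n; nra.
  apply: le_trans; rewrite x2 mulrA.
  have := low n; rewrite mulrA; set y := a n ^+ 2 * pi => l.
  have n0 : 0 <= n%:R :> R by [].
  have y0 : 0 <= y by rewrite mulr_ge0 ?sqr_ge0// ltW.
  rewrite -(@ler_pM2r _ n.+1%:R)// mulrBl mul1r mulVf ?pnatr_eq0// -(natr1 n).
  have := mulr_ge0 n0 (_ : 0 <= y * (n%:R + 2^-1) - 1); rewrite subr_ge0 => /(_ l).
  by have := mulr_ge0 n0 y0; lra.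
apply: (@squeeze_cvgr _ _ _ _ (fun n => 1 - n.+1%:R^-1) (fun=> 1)).
- by apply: nearW => n; rewrite xge xle.
- rewrite -[X in _ --> X]subr0; apply: cvgB; first exact: cvg_cst.
  exact: cvg_harmonic.
- exact: cvg_cst.
Qed.
End Wallis.

(** * First hits of the slit *)

Section Walk.
Variable R : realType.
Implicit Types (z : lpt) (n N : nat).

(** Only times strictly below [N] count, so [hit_by 0] is identically 0. *)
Definition hit_by N z : R := \sum_(n < N) first_hit R n z.

Lemma first_hit_ge0 n z : 0 <= first_hit R n z.
Proof.
elim: n z => [|n IH] z /=; first by case: ifP.
by case: ifP => // _; rewrite mulr_ge0 ?invr_ge0// !addr_ge0.
Qed.

(** First-step analysis: the averaging relation of a harmonic function, with a shift in time. *)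
Lemma hit_byS N z : hit_by N.+1 z = if inS z then (z == (0, 0))%:R else
  4^-1 * (hit_by N (z.1 + 1, z.2 + 1) + hit_by N (z.1 + 1, z.2 - 1)
        + hit_by N (z.1 - 1, z.2 + 1) + hit_by N (z.1 - 1, z.2 - 1)).
Proof.
rewrite /hit_by big_ord_recl /=.
have [zS|zS] := boolP (inS z).
  by rewrite big1 ?addr0; case: (z == _).
rewrite ifF; last by apply/negP => /eqP z0; rewrite z0 in zS.
rewrite add0r -!big_split /= mulr_sumr; exact: eq_bigr.
Qed.

Lemma hit_by_le1 N z : hit_by N z <= 1.
Proof.
elim: N z => [|N IH] z; first by rewrite /hit_by big_ord0.
rewrite hit_byS; case: ifP => _; first by case: (z == _).
rewrite ler_pdivrMl// mulr1.
by rewrite (_ : 4 = 1 + 1 + 1 + 1)// ?lerD//; ring.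
Qed.

(** The expectation of [m] at the distance to 0 of a simple walk on the integers after [n] steps
    from [k]; the second coordinate of the walk on the lattice is such a walk. *)
Fixpoint avg (m : nat -> R) n (k : int) : R :=
  if n is n'.+1 then 2^-1 * (avg m n' (k + 1) + avg m n' (k - 1)) else m `|k|%N.

Lemma avg_ge0 (m : nat -> R) : (forall j, 0 <= m j) -> forall n k, 0 <= avg m n k.
Proof.
by move=> m0; elim=> [|n IH] k //=; rewrite mulr_ge0 ?invr_ge0 ?addr_ge0.
Qed.

(** * Comparison of a decaying harmonic function with the hitting probabilities *)

Section Comparison.
Variables (h : lpt -> R) (m : nat -> R).
Hypothesis h_slit : forall z, inS z -> h z = (z == (0, 0))%:R.
Hypothesis h_harmonic : forall z, (2 %| z.1 + z.2)%Z -> ~~ inS z ->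
  h z = 4^-1 * (h (z.1 + 1, z.2 + 1) + h (z.1 + 1, z.2 - 1)
              + h (z.1 - 1, z.2 + 1) + h (z.1 - 1, z.2 - 1)).
Hypothesis h_bound : forall z, `|h z| <= m `|z.2|%N.
Hypothesis m_cvg0 : m n @[n --> \oo] --> 0.

Let m_ge0 j : 0 <= m j.
Proof. by have := h_bound (0, j%:Z); rewrite absz_nat; apply: le_trans. Qed.

(** On the slit the two functions agree after one step. Off it both average over four neighbours,
    two on row [k + 1] and two on row [k - 1], so the error is averaged along [k]. *)
Lemma dist_hit_by_le N z : (2 %| z.1 + z.2)%Z ->
  `|h z - hit_by N z| <= avg m N z.2.
Proof.
elim: N z => [|N IH] z ez.
  by rewrite /hit_by big_ord0 subr0 /= h_bound.
rewrite hit_byS; case: ifPn => zS.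
  by rewrite h_slit// subrr normr0 avg_ge0.
rewrite h_harmonic// -mulrBr normrM ger0_norm ?invr_ge0//.
have IH1 := IH (z.1 + 1, z.2 + 1); have IH2 := IH (z.1 + 1, z.2 - 1).
have IH3 := IH (z.1 - 1, z.2 + 1); have IH4 := IH (z.1 - 1, z.2 - 1).
have /= {}IH1 := IH1 ltac:(move=> /=; lia).
have /= {}IH2 := IH2 ltac:(move=> /=; lia).
have /= {}IH3 := IH3 ltac:(move=> /=; lia).
have /= {}IH4 := IH4 ltac:(move=> /=; lia).
rewrite /= (_ : 2^-1 = 4^-1 * 2); last by field.
rewrite -mulrA ler_pM2l ?invr_gt0//.
move: IH1 IH2 IH3 IH4; set a1 := h _; set a2 := h _; set a3 := h _; set a4 := h _.
set b1 := hit_by _ _; set b2 := hit_by _ _; set b3 := hit_by _ _; set b4 := hit_by _ _.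
rewrite !ler_norml => /andP[? ?] /andP[? ?] /andP[? ?] /andP[? ?].
by apply/andP; split; lra.
Qed.

(** The parabola continued by its tangents at [K] and [-K]. Its Laplacian detects visits to
    [|k| < K], while its linear growth keeps its mean along the walk sublinear in time. *)
Let huber (K x : R) := if `|x| <= K then x ^+ 2 else 2 * K * `|x| - K ^+ 2.

Let huber_ge K x : 0 <= K -> 2 * K * `|x| - K ^+ 2 <= huber K x.
Proof.
move=> K0; rewrite /huber; case: ifP => // _.
have -> : x ^+ 2 = `|x| ^+ 2 by rewrite real_normK ?num_real.
by set y := `|x|; have := sqr_ge0 (y - K); nra.
Qed.

(** From [2 K y <= e y^2 + K^2 / e]: the growth is traded for a square with arbitrarily small
    coefficient. *)
Let huber_le K x e : 0 <= K -> 0 < e -> huber K x <= e * x ^+ 2 + (K ^+ 2 / e + K ^+ 2).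
Proof.
move=> K0 e0; have h1 : 0 <= K ^+ 2 / e by rewrite divr_ge0 ?sqr_ge0 ?ltW.
have -> : x ^+ 2 = `|x| ^+ 2 by rewrite real_normK ?num_real.
rewrite /huber; have -> : x ^+ 2 = `|x| ^+ 2 by rewrite real_normK ?num_real.
have := normr_ge0 x; set y := `|x| => y0; case: ifPn => [yK|].
  have h2 : y ^+ 2 <= K ^+ 2 by nra.
  by have := mulr_ge0 (ltW e0) (sqr_ge0 y); lra.
move=> _; have h2 : 0 <= (e * y - K) ^+ 2 / e by rewrite divr_ge0 ?sqr_ge0 ?ltW.
have : (e * y - K) ^+ 2 / e = e * y ^+ 2 - 2 * K * y + K ^+ 2 / e.
  by field; rewrite gt_eqF.
by have := sqr_ge0 K; lra.
Qed.

(** If [|k| < K], both neighbours stay in the quadratic range, where the mean of [(x + 1)^2] and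
    [(x - 1)^2] is [x^2 + 1]. Otherwise [huber_ge] at the neighbours and the triangle inequality
    suffice. *)
Let huber_lap K (k : int) : huber K%:R k%:~R + (if (`|k| < K)%N then 1 else 0) <=
  2^-1 * (huber K%:R (k + 1)%:~R + huber K%:R (k - 1)%:~R).
Proof.
rewrite !intrD !rmorphN1 !mulr1z; set x : R := k%:~R.
have ax : `|x| = `|k|%N%:R by rewrite /x -intr_norm -abszE.
case: ifPn => [kK|].
  have xK : `|x| <= K%:R - 1.
    by rewrite ax lerBrDr natr1 ler_nat.
  have : `|x + 1| <= K%:R by rewrite (le_trans (ler_normD _ _))// normr1; lra.
  have : `|x - 1| <= K%:R by rewrite (le_trans (ler_normB _ _))// normr1; lra.
  have xK' : `|x| <= K%:R by lra.
  by rewrite /huber xK' => -> ->; lra.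
rewrite -leqNgt => kK.
have xK : K%:R <= `|x| by rewrite ax ler_nat.
have K0 : 0 <= K%:R :> R by [].
have hx : huber K%:R x = 2 * K%:R * `|x| - K%:R ^+ 2.
  rewrite /huber; case: ifP => // xK'.
  have -> : K%:R = `|x| by apply/eqP; rewrite eq_le xK.
  have -> : x ^+ 2 = `|x| ^+ 2 by rewrite real_normK ?num_real.
  by ring.
rewrite hx; have := huber_ge (x + 1) K0; have := huber_ge (x - 1) K0.
have : 2 * `|x| <= `|x + 1| + `|x - 1|.
  have := ler_normD (x + 1) (x - 1).
  rewrite (_ : x + 1 + (x - 1) = x *+ 2); last by rewrite mulr2n; ring.
  by rewrite normrMn mulr2n; lra.
set a := `|x + 1|; set b := `|x - 1|; set y := `|x|; set H1 := huber _ _.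
by set H2 := huber _ _; nra.
Qed.

(* Induction on [N]: the discrete Laplacian of [huber K] is at least the
   indicator of [|k| < K], and the walk adds 1 to the mean of [k ^+ 2] at each step. *)
Lemma sum_avg_le (e M e' : R) K : 0 <= M -> 0 < e' ->
  (forall j, m j <= e + (if (j < K)%N then M else 0)) ->
  forall N k, \sum_(n < N) avg m n k <= e * N%:R +
    M * (e' * (k%:~R ^+ 2 + N%:R) + (K%:R ^+ 2 / e' + K%:R ^+ 2) - huber K%:R k%:~R).
Proof.
move=> M0 e0 mle; elim=> [|N IH] k.
  rewrite big_ord0 mulr0 add0r addr0 mulr_ge0// subr_ge0 huber_le//.
rewrite big_ord_recl /= -mulr_sumr big_split /=.
have := IH (k + 1); have := IH (k - 1).
have := mle `|k|%N; have := huber_lap K k.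
rewrite !intrD !rmorphN1 !mulr1z -(natr1 N); set x : R := k%:~R.
set H := huber _ x; set H1 := huber _ (x + 1); set H2 := huber _ (x - 1).
set C := K%:R ^+ 2 / e' + _; set S1 := \sum_(i < N) _; set S2 := \sum_(i < N) _.
move=> lap mk h2 h1.
have hM : m `|k|%N <= e + M * (2^-1 * (H1 + H2) - H).
  rewrite (le_trans mk)// lerD2l.
  have -> : (if (`|k| < K)%N then M else 0) = M * (if (`|k| < K)%N then 1 else 0).
    by case: ifP; rewrite ?mulr1 ?mulr0.
  by rewrite ler_wpM2l// lerBrDl.
have -> : e' * (x ^+ 2 + (N%:R + 1)) + C - H =
  2^-1 * ((e' * ((x + 1) ^+ 2 + N%:R) + C - H1) + (e' * ((x - 1) ^+ 2 + N%:R) + C - H2))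
  + (2^-1 * (H1 + H2) - H) by field.
lra.
Qed.

(** A limit [l] exists by monotonicity. A gap [L = |h z - l| > 0] would keep [avg m n] above [L / 2]
    for large [n], against the bound [L / 4 * N + C] on its sums. *)
Lemma hit_by_cvg z : (2 %| z.1 + z.2)%Z -> hit_by N z @[N --> \oo] --> h z.
Proof.
move=> ez.
have nd : nondecreasing_seq (hit_by ^~ z).
  apply/nondecreasing_seqP => N.
  by rewrite /hit_by big_ord_recr /= lerDl first_hit_ge0.
have /cvg_ex[l ul] : cvgn (hit_by ^~ z).
  apply: nondecreasing_is_cvgn => //.
  by exists 1 => _ [N _ <-]; exact: hit_by_le1.
suff -> : h z = l by [].
apply/eqP; rewrite -subr_eq0 -normr_le0 leNgt; apply/negP => L0.
set L := `|h z - l| in L0.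
have [N0 _ HN0] : \forall n \near \oo, `|l - hit_by n z| < L / 2.
  by move/cvgrPdist_lt : ul; apply; rewrite divr_gt0.
have low n : (N0 <= n)%N -> L / 2 <= avg m n z.2.
  move=> /HN0 /= hn; apply: le_trans (dist_hit_by_le n ez).
  have : L <= `|h z - hit_by n z| + `|l - hit_by n z|.
    rewrite [X in _ <= _ + X]distrC (le_trans _ (ler_normD _ _))//.
    by rewrite /L addrA subrK.
  by move: hn; lra.
have [K _ HK] : \forall j \near \oo, `|0 - m j| < L / 8.
  by move/cvgrPdist_lt : m_cvg0; apply; rewrite divr_gt0.
(* The sum serves as a common bound for the finitely many [m j] with [j < K]. *)
pose M := \sum_(j < K) m j.
have M0 : 0 <= M by rewrite sumr_ge0.
have mle j : m j <= L / 8 + (if (j < K)%N then M else 0).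
  case: ifPn => jK.
    have L8 : 0 <= L / 8 by rewrite divr_ge0 // ltW.
    rewrite ler_wpDl//.
    by rewrite /M (bigD1 (Ordinal jK))//= lerDl sumr_ge0.
  rewrite -leqNgt in jK; have := HK j jK.
  by rewrite /= sub0r normrN ger0_norm// addr0 => /ltW.
(* Chosen so that [M * e' <= L / 8]; the added 1 covers [M = 0]. *)
pose e' := L / (8 * (M + 1)).
have e0 : 0 < e' by rewrite divr_gt0// mulr_gt0// ltr_wpDl.
have Me : M * e' <= L / 8.
  rewrite (_ : L / 8 = (M + 1) * e') ?ler_wpM2r ?lerDl ?ltW//.
  by rewrite /e'; field; rewrite gt_eqF// ltr_wpDl.
have up := sum_avg_le M0 e0 mle.
pose x : R := z.2%:~R.
pose C := M * (e' * x ^+ 2 + (K%:R ^+ 2 / e' + K%:R ^+ 2) - huber K%:R x).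
have upN N : \sum_(n < N) avg m n z.2 <= L / 4 * N%:R + C.
  rewrite (le_trans (up N z.2))// -/x.
  have : M * e' * N%:R <= L / 8 * N%:R by rewrite ler_wpM2r.
  by rewrite /C; lra.
have lowN N : L / 2 * (N%:R - N0%:R) <= \sum_(n < N) avg m n z.2.
  elim: N => [|N IH].
    by rewrite big_ord0 sub0r mulrN oppr_le0 mulr_ge0// divr_ge0// ltW.
  rewrite big_ord_recr /= -(natr1 N).
  have [lt|ge] := ltnP N N0; last by have := low N ge; lra.
  have a0 := avg_ge0 m_ge0 N z.2.
  have s0 : 0 <= \sum_(i < N) avg m i z.2 by rewrite sumr_ge0// => i _; exact: avg_ge0.
  have : N%:R + 1 <= N0%:R :> R by rewrite natr1 ler_nat.
  by move=> ?; rewrite (@le_trans _ _ 0)//; nra.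
(* Beyond [B] the lower bound [L / 2 * (N - N0)] exceeds the upper bound [L / 4 * N + C]. *)
pose B := 4 / L * (C + L / 2 * N0%:R).
have [N HN] : exists N : nat, B < N%:R.
  by exists (Num.bound `|B|); rewrite (le_lt_trans (ler_norm _) (archi_boundP _)).
have := le_trans (lowN N) (upN N).
have : C + L / 2 * N0%:R = L / 4 * B by rewrite /B; field; rewrite gt_eqF.
have : L / 4 * B < L / 4 * N%:R by rewrite ltr_pM2l ?divr_gt0.
lra.
Qed.

Lemma hm_eq z : (2 %| z.1 + z.2)%Z -> hm R z = h z.
Proof.
move=> ez; rewrite /hm.
suff -> : (\sum_(0 <= n <oo) (first_hit R n z)%:E)%E = (h z)%:E by [].
have cv : (hit_by N z)%:E @[N --> \oo] --> (h z)%:E.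
  apply: cvg_EFin; first exact: nearW.
  exact: hit_by_cvg ez.
apply/cvg_lim => //; apply: cvg_trans cv.
apply: near_eq_cvg; apply: nearW => N.
by rewrite /hit_by -sumEFin big_mkord.
Qed.

End Comparison.
End Walk.

(** * Reduction of the complex integrand to [0, pi] *)

Section Reflection.
Variable R : realType.
Implicit Types (f g : R -> R) (h : R -> \bar R) (D : set R).
Local Notation mu := (@lebesgue_measure R).

Lemma ge0_integral_opp D h : measurable D -> measurable_fun D h ->
  (forall x, D x -> 0 <= h x)%E ->
  (\int[mu]_(x in -%R @^-1` D) h (- x)%R = \int[mu]_(x in D) h x)%E.
Proof.
move=> mD mh h0.
have mN := @oppr_measurable R setT.
pose N := -%R : measurableTypeR R -> measurableTypeR R.
transitivity (\int[pushforward mu N]_(x in D) h x)%E; last first.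
  by apply: eq_measure_integral => /= A mA AD; exact: lebesgue_measureN.
rewrite ge0_integral_pushforward//.
by move=> x; rewrite inE; exact: h0.
Qed.

Lemma integral_opp D h : measurable D -> measurable_fun D h ->
  (\int[mu]_(x in -%R @^-1` D) h (- x)%R = \int[mu]_(x in D) h x)%E.
Proof.
move=> mD mh; rewrite integralE [RHS]integralE.
congr (_ - _)%E.
  rewrite -(ge0_integral_opp mD (measurable_funepos mh)); last first.
    by move=> x _; exact: funepos_ge0.
  by apply: eq_integral => x _; rewrite !funeposE.
rewrite -(ge0_integral_opp mD (measurable_funeneg mh)); last first.
  by move=> x _; exact: funeneg_ge0.
by apply: eq_integral => x _; rewrite !funenegE.
Qed.

Lemma integrable_opp D h : measurable D -> mu.-integrable D h ->
  mu.-integrable (-%R @^-1` D) (h \o -%R).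
Proof.
move=> mD /integrableP[mh fh]; apply/integrableP; split.
  apply: (measurable_comp mD _ mh); last exact: oppr_measurable.
  by move=> _ [x /= Dx <-].
rewrite (_ : integral _ _ _ = (\int[mu]_(x in D) `|h x|)%E)//.
rewrite -(ge0_integral_opp mD)//; exact: measurableT_comp.
Qed.

End Reflection.

Section Parity.
Variable R : realType.
Local Notation mu := (@lebesgue_measure R).

(** Used with [e = 1] for the even real part and [e = -1] for the odd imaginary part. The points 0,
    [a] and [- a] have measure zero. *)
Lemma Rintegral_parity (f g : R -> R) (a e : R) : 0 < a ->
  mu.-integrable `]0, a[ (EFin \o g) ->
  (forall t, 0 < t < a -> f t = g t) ->
  (forall t, 0 < t < a -> f (- t) = e * g t) ->
  mu.-integrable `[- a, a] (EFin \o f) /\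
  Rintegral mu `[- a, a] f = (1 + e) * Rintegral mu `]0, a[ g.
Proof.
move=> a0 ig fg fNg.
have Nitv : -%R @^-1` `]0, a[ = `](- a), 0[%classic :> set R.
  by apply/seteqP; split => x /=; rewrite !in_itv/= oppr_gt0 ltrNl andbC.
have ir : mu.-integrable `]0, a[ (EFin \o f).
  by apply: eq_integrable ig => // x; rewrite inE/= in_itv => /fg ->.
have ieg : mu.-integrable `]0, a[ (EFin \o (fun t => e * g t)).
  by have := integrableZl _ e ig; apply.
have il : mu.-integrable `](- a), 0[ (EFin \o f).
  have := integrable_opp (measurable_itv _) ieg; rewrite Nitv.
  apply: eq_integrable => // x; rewrite inE/= in_itv/= => /andP[x1 x2].
  by rewrite -fNg ?opprK// oppr_gt0 x2 ltrNl.
have split : `[- a, a] = `[- a, 0] `|` `]0, a] :> set R.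
  apply/seteqP; split => x /=; rewrite !in_itv/=.
    by move=> /andP[-> ->]; case: (leP x 0) => ?; [left|right].
  by move=> [|] /andP[h1 h2]; apply/andP; split; lra.
have mil : measurable_fun `](- a), 0[ (EFin \o f) := measurable_int mu il.
have mir : measurable_fun `]0, a[ (EFin \o f) := measurable_int mu ir.
have ml : measurable_fun `[- a, 0] (EFin \o f) by exact: emeasurable_fun_itv_cc mil.
have mr : measurable_fun `]0, a] (EFin \o f) by exact/emeasurable_fun_itv_bndo_bndcP.
have disj : [disjoint (`[- a, 0] : set R) & `]0, a]].
  by apply/disj_setPS => x [] /=; rewrite !in_itv/= => /andP[_ h1] /andP[h2 _]; lra.
have mabs (A : set R) : measurable_fun A (EFin \o f) -> measurable_fun A (abse \o (EFin \o f)).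
  by move=> mA; exact: measurableT_comp.
have ifull : mu.-integrable `[- a, a] (EFin \o f).
  rewrite split; apply/integrableP; split; first exact/measurable_funU.
  rewrite ge0_integral_setU//; last by apply: mabs; exact/measurable_funU.
  rewrite lte_add_pinfty//.
    rewrite integral_itv_bndoo; last exact: mabs.
    by have /integrableP[] := il.
  rewrite integral_itv_bndoo; last exact: mabs.
  by have /integrableP[] := ir.
split => //.
rewrite [in LHS]split Rintegral_setU -?split//.
rewrite [X in X + _](_ : _ = e * Rintegral mu `]0, a[ g); last first.
  rewrite -RintegralZl// /Rintegral integral_itv_bndoo//; congr fine.
  rewrite -(integral_opp (measurable_itv _) (measurable_int mu ieg)) Nitv.
  apply: eq_integral => x; rewrite inE/= in_itv/= => /andP[x1 x2].
  by rewrite -fNg ?opprK// oppr_gt0 x2 ltrNl.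
rewrite addrC mulrDl mul1r; congr (_ + _).
rewrite /Rintegral integral_itv_bndoo//; congr fine.
by apply: eq_integral => x; rewrite inE/= in_itv => /fg ->.
Qed.

End Parity.

(** * Polar form of the integrand *)

Section Integrand.
Variable R : realType.
Implicit Types (x y t : R).
Local Open Scope complex_scope.

Lemma expiD x y : expi (x + y) = expi x * expi y.
Proof.
by rewrite /expi cosD sinD; apply/eqP; rewrite eq_complex /=; apply/andP; split;
  apply/eqP; ring.
Qed.

Lemma expi0 : expi (0 : R) = 1.
Proof. by rewrite /expi cos0 sin0. Qed.

Lemma invr_expi x : (expi x)^-1 = expi (- x).
Proof.
have e : expi x * expi (- x) = 1 by rewrite -expiD subrr expi0.
have n0 : expi x != 0.
  by apply/eqP => h; move: e; rewrite h mul0r => /eqP; rewrite eq_sym oner_eq0.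
by apply: (mulfI n0); rewrite e divff.
Qed.

(** The two square roots are opposite, and the principal one has nonnegative real part. *)
Lemma sqrtc_uniq (w z : R[i]) : 0 < complex.Re w -> w ^+ 2 = z -> sqrtc z = w.
Proof.
move=> w0 wz; have /eqP : sqrtc z ^+ 2 = w ^+ 2 by rewrite sqr_sqrtc.
rewrite eqf_sqr => /orP[/eqP//|/eqP h].
have : 0 <= complex.Re (sqrtc z) by case: z {wz h} => a b; rewrite /= sqrtr_ge0.
rewrite h; case: w w0 {wz h} => a b /=; by rewrite oppr_ge0 leNgt => ->.
Qed.

Lemma Re_real_expi x y : complex.Re (x%:C * expi y) = x * cos y.
Proof. by rewrite /expi; simpc. Qed.

Lemma Im_real_expi x y : complex.Im (x%:C * expi y) = x * sin y.
Proof. by rewrite /expi; simpc. Qed.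

(** The sign [(-1) ^+ e] treats both halves of [[-pi, pi]] at once. The angle [pi / 4 - t / 2] has
    positive cosine, which selects the principal branch. *)
Lemma sqrtc_1Bexpi t (e : bool) : 0 < t < pi ->
  sqrtc (1 - expi (- (2 * ((-1) ^+ e * t)))) =
  (Num.sqrt (2 * sin t))%:C * expi ((-1) ^+ e * (pi / 4 - t / 2)).
Proof.
move=> t0; have st := sin_gt0_pi t0; have [h1 h2] := andP t0.
have p0 := pi_gt0 R.
apply: sqrtc_uniq.
  rewrite Re_real_expi mulr_gt0// ?sqrtr_gt0 ?mulr_gt0// cos_gt0_pihalf//.
  by case: e; rewrite ?expr0 ?expr1; apply/andP; split; lra.
have r2 : (Num.sqrt (2 * sin t))%:C * (Num.sqrt (2 * sin t))%:C = (2 * sin t)%:C :> R[i].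
  by rewrite -rmorphM /= -expr2 sqr_sqrtr// mulr_ge0// ltW.
rewrite expr2 mulrACA r2 -expiD -mulrDr.
have -> : pi / 4 - t / 2 + (pi / 4 - t / 2) = pi / 2 - t by field.
have -> : - (2 * ((-1) ^+ e * t)) = (-1) ^+ e * (- t + - t) by ring.
rewrite /expi.
have c2 : cos (t + t) = 1 - 2 * sin t ^+ 2.
  by rewrite cosD -!expr2 cos2sin2; ring.
have s2 : sin (t + t) = 2 * (sin t * cos t) by rewrite sinD; ring.
have cp : cos (pi / 2 - t) = sin t.
  by rewrite cosB cos_pihalf sin_pihalf; ring.
have sp : sin (pi / 2 - t) = cos t.
  by rewrite sinB cos_pihalf sin_pihalf; ring.
case: e; rewrite ?expr0 ?expr1 ?mul1r ?mulN1r -opprD ?opprK ?cosN ?sinN c2 s2 cp sp.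
  by simpc; congr (_ +i* _); ring.
by simpc; congr (_ +i* _); ring.
Qed.

Lemma hm_integrandE (s k : int) t (e : bool) : 0 < t < pi ->
  hm_integrand s k ((-1) ^+ e * t) =
  (Cth t ^+ `|k| / Num.sqrt (2 * sin t))%:C *
    expi (- ((-1) ^+ e * ((s%:~R - 2^-1) * t + pi / 4))).
Proof.
move=> t0; rewrite /hm_integrand sqrtc_1Bexpi//.
have -> : Cth ((-1) ^+ e * t) = Cth t.
  by case: e; rewrite ?expr0 ?expr1 ?mul1r// mulN1r /Cth cosN sinN normrN.
rewrite invfM invr_expi mulrACA -expiD.
congr (_ * expi _); last by field.
by move: (Cth t) (Num.sqrt _) => c r; rewrite rmorphM /= fmorphV rmorphXn.
Qed.

Lemma hm_integrand_Rintegral (s k : int) :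
  let f := @hm_integrand R s k in
  [/\ lebesgue_measure.-integrable `[- pi, pi] (EFin \o (fun t => complex.Re (f t))),
      lebesgue_measure.-integrable `[- pi, pi] (EFin \o (fun t => complex.Im (f t))),
      (2 * pi)^-1 * Rintegral lebesgue_measure `[- pi, pi] (fun t => complex.Re (f t))
        = hmint s%:~R `|k|
    & Rintegral lebesgue_measure `[- pi, pi] (fun t => complex.Im (f t)) = 0].
Proof.
move=> f.
have bC : bcont (fun t : R => (Num.sqrt 2)^-1 * Cth t ^+ `|k|).
  by apply: bcontZ; apply: bcontX; exact: bcont_Cth.
pose phi t : R := (s%:~R - 2^-1) * t + pi / 4.
pose p t := (Num.sqrt 2)^-1 * Cth t ^+ `|k| * cos (phi t).
pose q t := (-1) * ((Num.sqrt 2)^-1 * Cth t ^+ `|k| * sin (phi t)).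
have bp : bcont p by apply: bcontM bC (bcont_cos _ _).
have bq : bcont q by apply: bcontZ; apply: bcontM bC (bcont_sin _ _).
have sq t : 0 < t < pi -> Num.sqrt (2 * sin t) = Num.sqrt 2 * Num.sqrt (sin t).
  by move=> t0; rewrite sqrtrM.
have fp t (e : bool) : 0 < t < pi ->
    f ((-1) ^+ e * t) = (Cth t ^+ `|k| / (Num.sqrt 2 * Num.sqrt (sin t)))%:C *
      expi (- ((-1) ^+ e * phi t)).
  by move=> t0; rewrite /f hm_integrandE// sq.
have [i1 e1] := @Rintegral_parity R (fun t => complex.Re (f t))
  (fun t => p t / Num.sqrt (sin t)) pi 1 (pi_gt0 R) (bcont_integrable bp)
  ltac:(move=> t t0; have := fp t false t0; rewrite expr0 !mul1r => ->;
        rewrite Re_real_expi cosN /p invfM; ring)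
  ltac:(move=> t t0; have := fp t true t0; rewrite expr1 !mulN1r opprK => ->;
        rewrite Re_real_expi /p invfM; ring).
have [i2 e2] := @Rintegral_parity R (fun t => complex.Im (f t))
  (fun t => q t / Num.sqrt (sin t)) pi (-1) (pi_gt0 R) (bcont_integrable bq)
  ltac:(move=> t t0; have := fp t false t0; rewrite expr0 !mul1r => ->;
        rewrite Im_real_expi sinN /q invfM; ring)
  ltac:(move=> t t0; have := fp t true t0; rewrite expr1 !mulN1r opprK => ->;
        rewrite Im_real_expi /q invfM; ring).
split=> //; last by rewrite e2 subrr mul0r.
rewrite e1 -/(wint p) /hmint.
have -> : wint p = (Num.sqrt 2)^-1 * wint (fun t => Cth t ^+ `|k| * wave s%:~R t).
  rewrite -wintZ; last exact: bcont_Cth_wave.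
  by apply: eq_wint => t _; rewrite /p /wave -mulrA.
have r0 : Num.sqrt 2 != 0 :> R by rewrite gt_eqF// sqrtr_gt0.
have : pi != 0 :> R by rewrite gt_eqF// pi_gt0.
move: (wint _) => W; move: (pi : R) => P P0.
by field; rewrite P0 r0.
Qed.
End Integrand.

(** * Identification with the harmonic measure *)

Section HarmonicMeasure.
Variable R : realType.
Implicit Types (z : lpt) (n : nat).

Let h z : R := hmint z.1%:~R `|z.2|.

Lemma hmint_on_slit z : inS z -> h z = (z == (0, 0))%:R.
Proof.
case: z => s k; rewrite /inS /h /= => /and3P[/eqP -> s0 sd].
case: s s0 sd => // -[|n] _ sd; first by rewrite hmint_origin.
have [m e] : exists m, n.+1 = (2 * m.+1)%N by exists (n.+1 %/ 2).-1; lia.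
rewrite [RHS](_ : _ = 0)//.
by have := hmint_slit_pos R m; rewrite -natrM -e pmulrn.
Qed.

(** On the axis, parity makes [s] even, hence negative off the slit, and [hmint_harmonic_slit]
    applies. Elsewhere the sign of [k] only decides which vertical neighbour is farther from the
    axis. *)
Lemma hmint_off_slit z : (2 %| z.1 + z.2)%Z -> ~~ inS z ->
  h z = 4^-1 * (h (z.1 + 1, z.2 + 1) + h (z.1 + 1, z.2 - 1)
              + h (z.1 - 1, z.2 + 1) + h (z.1 - 1, z.2 - 1)).
Proof.
case: z => s k; rewrite /inS /h /= !intrD !rmorphN1 !mulr1z.
have [->|k0] := eqVneq k 0.
  rewrite addr0 => sd; rewrite sd andbT /= -ltNge => s0.
  have [n ->] : exists n : nat, s = - (2 * n.+1%:Z).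
    by exists (`|s| %/ 2).-1; lia.
  rewrite add0n subn0.
  have := hmint_harmonic_slit R n.
  have -> : (- (2 * n.+1%:Z))%:~R = - (2 * n.+1%:R) :> R.
    by rewrite rmorphN rmorphM.
  by move=> /= e; lra.
move=> _ _.
have [n [-> [[-> ->]|[-> ->]]]] : exists n : nat, `|k|%N = n.+1 /\
    (`|(k + 1)%R|%N = n.+2 /\ `|(k - 1)%R|%N = n \/
     `|(k + 1)%R|%N = n /\ `|(k - 1)%R|%N = n.+2).
  by exists `|k|%N.-1; lia.
- by have := hmint_harmonic (s%:~R : R) n; lra.
- by have := hmint_harmonic (s%:~R : R) n; lra.
Qed.

Lemma hm_hmint z : (2 %| z.1 + z.2)%Z -> hm R z = hmint z.1%:~R `|z.2|.
Proof.
apply: (@hm_eq R h (hmbound R)).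
- exact: hmint_on_slit.
- exact: hmint_off_slit.
- by move=> z'; exact: norm_hmint_le.
- exact: hmbound_cvg0.
Qed.

Lemma hm_neg n : hm R (- (2 * n%:Z), 0) = hmint (- (2 * n%:R)) 0.
Proof.
rewrite hm_hmint /=; last by lia.
by rewrite rmorphN rmorphM.
Qed.
End HarmonicMeasure.

Local Open Scope complex_scope.

Theorem theorem2p11 (R : realType) :
  (forall s k : int, (2 %| s + k)%Z ->
     let f := @hm_integrand R s k in
     lebesgue_measure.-integrable `[- pi, pi] (fun t => (complex.Re (f t))%:E) /\
     lebesgue_measure.-integrable `[- pi, pi] (fun t => (complex.Im (f t))%:E) /\
     ((hm R (s, k))%:C =
       ((2 * pi)^-1 * Rintegral lebesgue_measure `[- pi, pi] (fun t => complex.Re (f t)))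
       +i* ((2 * pi)^-1 * Rintegral lebesgue_measure `[- pi, pi] (fun t => complex.Im (f t))))%C)
  /\
  (forall s : nat,
     hm R (- (2 * (s.+1)%:Z), 0) = (s%:R + 2^-1) / (s.+1)%:R * hm R (- (2 * s%:Z), 0))
  /\
  ((fun s : nat => hm R (- (2 * s%:Z), 0) * Num.sqrt (pi * s%:R)) @ \oo --> (1 : R)).
Proof.
split; last split.
- move=> s k sk f.
  have [i1 i2 e1 e2] := hm_integrand_Rintegral R s k.
  do 2![split => //].
  by rewrite e1 e2 mulr0 hm_hmint.
- by move=> s; rewrite !hm_neg hmint_slit_neg.
- under eq_fun do rewrite hm_neg.
  apply: wallis_cvg; first by rewrite mulr0 oppr0 hmint_origin.
  exact: hmint_slit_neg.
Qed.
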